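(* Assume the setting and standing assumptions given in the context, let $T\ge 0$ be the number from assumption (ii), and let $t_1>T$. Then the equation $\dot x(t)=Ax(t)+bu(t)$, $x(0)=x_0$, is exact null-controllable on $[0,t_1]$ by controls vanishing after time moment $t_1-T$ if and only if for every $x_0\in X$ the infinite moment problem $$x_{0j}=-\int_0^{t_1-T}e^{-\lambda_j\tau}\,b_j\,u(\tau)\,d\tau,\qquad j=1,2,\dots,$$ where $x_{0j}=(x_0,\psi_j)$ and $b_j=(b,\psi_j)$, has a solution $u(\cdot)\in L_2[0,t_1-T]$.
   Context: Setting: $X$ is a separable complex Hilbert space; $A$ is the infinitesimal generator of a strongly continuous ($C_0$) semigroup $S(t)$ on $X$. $W\subset X\subset V$ are Hilbert spaces with continuous dense injections, where $W=D(A^* )$ with the graph norm and $V=W^*$ is its dual with respect to the pivot space $X$. For each $t\ge 0$, $S(t)$ extends uniquely to a bounded operator $\mathcal S(t)$ on $V$, and $\mathcal S(t)$ is a $C_0$-semigroup on $V$ whose generator extends $A$ and has domain $X$. The control space is $U=\mathbb C$ (one input), and the (possibly unbounded) input operator is $u\mapsto bu$ with a fixed $b\in V$. $(\cdot,\cdot)$ denotes the inner product of $X$ and also its extension to the duality pairing of $V$ with $W$. The mild solution of $\dot x(t)=Ax(t)+bu(t)$, $x(0)=x_0\in X$, is $x(t,x_0,u(\cdot))=S(t)x_0+\int_0^t\mathcal S(t-\tau)bu(\tau)\,d\tau$ (Bochner integral in $V$). It is assumed that $\int_0^t\mathcal S(t-\tau)bu(\tau)\,d\tau\in X$ for all $u(\cdot)\in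 L_2^{\rm loc}[0,+\infty)$ and $t\ge0$. Standing assumptions on $A$: (i) $A$ has purely point spectrum $\sigma$ with no finite limit points, and all eigenvalues have (algebraic) multiplicity $1$. (ii) There exists $T\ge0$ such that every mild solution of $\dot x(t)=Ax(t)$ expands in a series of eigenvectors of $A$ which converges uniformly in $t\in[T_1,T_2]$ for any $T<T_1<T_2$. Notation: $\lambda_j$, $j=1,2,\dots$, are the eigenvalues of $A$, enumerated in order of non-decreasing absolute value; $\varphi_j$ and $\psi_j$ are corresponding eigenvectors of $A$ and $A^*$ ($A\varphi_j=\lambda_j\varphi_j$, $A^*\psi_j=\overline{\lambda_j}\psi_j$), normalized so that $(\varphi_k,\psi_j)=\delta_{kj}$. The number $b_j=(b,\psi_j)$ is well defined since $\psi_j\in W$, $b\in V$. $L_2[0,s]$ is the space of complex-valued square integrable functions. Definition: the equation is exact null-controllable on $[0,t_1]$ by controls vanishing after time moment $t_2$ if for each $x_0\in X$ there is a control $u(\cdot)\in L_2[0,t_2]$, with $u(t)=0$ a.e. on $[t_2,+\infty)$, such that $x(t_1,x_0,u(\cdot))=0$. *)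

(* Defs.v *)
From HB Require Import structures.
From mathcomp Require Import all_boot all_order all_algebra.
From mathcomp Require Import complex.
From mathcomp Require Import all_classical all_reals all_analysis.

Set Implicit Arguments.
Unset Strict Implicit.
Unset Printing Implicit Defensive.
Import Order.TTheory GRing.Theory Num.Theory.
Import numFieldNormedType.Exports.
Local Open Scope classical_set_scope.
Local Open Scope complex_scope.
Local Open Scope ring_scope.

(* The inner product is linear in its first argument. *)
HB.mixin Record CompleteNormedModule_isHilbert (R : realType) (X : Type)
    of CompleteNormedModule R[i] X := {
  inner : X -> X -> R[i];
  inner_linearl : forall (a : R[i]) (x y z : X),
    inner (a *: x + y) z = a * inner x z + inner y z;
  inner_conj : forall x y : X, inner y x = (inner x y)^*;
  inner_norm : forall x : X, inner x x = `|x| ^+ 2 }.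

#[short(type="hilbertType")]
HB.structure Definition Hilbert (R : realType) :=
  { X of CompleteNormedModule_isHilbert R X & CompleteNormedModule R[i] X }.

(* In a normed module over R[i] the norm `|x| has type R[i]. *)
Definition rnorm (R : realType) (X : normedModType R[i]) (x : X) : R :=
  complex.Re `|x|.

Definition separable (T : topologicalType) : Prop :=
  exists D : set T, countable D /\ dense D.

Section Complex_functions.
Variable R : realType.
Local Notation mu := (@lebesgue_measure R).

Definition expC (z : R[i]) : R[i] :=
  (expR (complex.Re z))%:C * (cos (complex.Im z) +i* sin (complex.Im z)).

Definition cintegral (D : set R) (f : R -> R[i]) : R[i] :=
  Rintegral mu D (fun t => complex.Re (f t)) +i*
  Rintegral mu D (fun t => complex.Im (f t)).

Definition in_L2 (D : set R) (u : R -> R[i]) : Prop :=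
  [/\ measurable_fun D (fun t => complex.Re (u t)),
      measurable_fun D (fun t => complex.Im (u t)) &
      (\int[mu]_(t in D)
         (complex.Re (u t) ^+ 2 + complex.Im (u t) ^+ 2)%:E < +oo)%E].

Definition in_L2loc (u : R -> R[i]) : Prop :=
  forall s : R, 0 <= s -> in_L2 `[0, s] u.

End Complex_functions.

Section Bochner.
Variables (R : realType) (V : normedModType R[i]).
Local Notation mu := (@lebesgue_measure R).

(* The list [:: (E_1, v_1); ...; (E_n, v_n)] stands for the simple function
   \sum_i \1_(E_i) v_i. *)
Definition simple_eval (s : seq (set R * V)) (t : R) : V :=
  \sum_(p <- s) (\1_(p.1) t : R[i]) *: p.2.

Definition simple_integral (s : seq (set R * V)) : V :=
  \sum_(p <- s) (fine (mu p.1))%:C *: p.2.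

Definition simple_on (D : set R) (s : seq (set R * V)) : Prop :=
  forall p, p \in s -> [/\ measurable p.1, p.1 `<=` D & (mu p.1 < +oo)%E].

(* f is Bochner integrable on D, with integral v. *)
Definition is_bochner_integral (D : set R) (f : R -> V) (v : V) : Prop :=
  exists s : nat -> seq (set R * V),
    [/\ forall n, simple_on D (s n),
        forall n, measurable_fun D (fun t => rnorm (f t - simple_eval (s n) t)),
        (\int[mu]_(t in D) (rnorm (f t - simple_eval (s n) t))%:E)%E
          @[n --> \oo] --> 0%E &
        simple_integral (s n) @[n --> \oo] --> v].

End Bochner.

Section Operators.
Variable R : realType.

Record C0_semigroup (X : normedModType R[i]) (S : R -> X -> X) : Prop := {
  semigroup_linear : forall t, 0 <= t -> linear (S t);
  semigroup_bounded : forall t, 0 <= t -> continuous (S t);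
  semigroup_0 : forall x, S 0 x = x;
  semigroup_D : forall s t, 0 <= s -> 0 <= t ->
    forall x, S (s + t) x = S s (S t x);
  semigroup_strong : forall x, S h x @[h --> 0^'+] --> x }.

(* An unbounded operator A in X is given by its graph: A x y means that x
   belongs to D(A) and A x = y. *)
Definition is_generator (X : normedModType R[i])
    (A : X -> X -> Prop) (S : R -> X -> X) : Prop :=
  forall x y, A x y <-> h%:C^-1 *: (S h x - x) @[h --> 0^'+] --> y.

(* For densely defined A this is the graph of an operator. *)
Definition adjoint (X : hilbertType R) (A : X -> X -> Prop) : X -> X -> Prop :=
  fun y z => forall x x', A x x' -> inner x' y = inner x z.

Definition eigenvalues (X : normedModType R[i]) (A : X -> X -> Prop) : set R[i] :=
  [set l | exists x, x != 0 /\ A x (l *: x)].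

Definition resolvent_set (X : normedModType R[i]) (A : X -> X -> Prop) :
    set R[i] :=
  [set l | (forall y, exists x x', A x x' /\ l *: x - x' = y) /\
           (exists M : R, forall x x', A x x' ->
              rnorm x <= M * rnorm (l *: x - x'))].

Definition spectrum (X : normedModType R[i]) (A : X -> X -> Prop) : set R[i] :=
  ~` resolvent_set A.

(* (A - l)^n x = 0, with all the powers defined at x. *)
Fixpoint root_vector (X : normedModType R[i]) (A : X -> X -> Prop) (l : R[i])
    (n : nat) (x : X) : Prop :=
  if n is m.+1 then exists x', A x x' /\ root_vector A l m (x' - l *: x)
  else x = 0.

(* The algebraic multiplicity of l, that is the dimension of its root
   subspace, is 1. *)
Definition algebraically_simple (X : normedModType R[i])
    (A : X -> X -> Prop) (l : R[i]) : Prop :=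
  exists e : X, e != 0 /\
    forall x, (exists n, root_vector A l n x) <-> (exists c : R[i], x = c *: e).

Definition simple_discrete_spectrum (X : normedModType R[i])
    (A : X -> X -> Prop) : Prop :=
  [/\ spectrum A = eigenvalues A,
      limit_point (spectrum A : set R[i]^o) = set0 &
      forall l, eigenvalues A l -> algebraically_simple A l].

Definition eigenvalue_enumeration (X : normedModType R[i])
    (A : X -> X -> Prop) (lam : nat -> R[i]) : Prop :=
  [/\ injective lam, range lam = eigenvalues A &
      forall j k, (j <= k)%N -> `|lam j| <= `|lam k|].

(* The mild solutions of x' = A x are the orbits t |-> S t x; the n-th term of
   the expansion of S t x is the multiple c n t of the eigenvector phi n. *)
Definition eigenvector_expansion (X : normedModType R[i]) (S : R -> X -> X)
    (phi : nat -> X) (T : R) : Prop :=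
  forall x, exists c : nat -> R -> R[i],
    forall T1 T2, T < T1 -> T1 < T2 ->
      {uniform `[T1, T2], (fun (n : nat) (t : R) =>
          \sum_(j < n) c j t *: phi j) @ \oo --> (fun t => S t x)}.

(* W is D(A^* ) with the graph norm, embedded in X by i; V is the space of
   bounded antilinear functionals on W with the dual norm, X being embedded in
   it by j; pairing extends the inner product of X to V and W. *)
Record pivot_triple (X : hilbertType R) (A : X -> X -> Prop)
    (W V : hilbertType R) (i : W -> X) (j : X -> V) (pairing : V -> W -> R[i]) :
    Prop := {
  triple_i_linear : linear i;
  triple_i_inj : injective i;
  triple_i_continuous : continuous i;
  triple_i_dense : dense (range i);
  triple_i_range : range i = [set y | exists z, adjoint A y z];
  triple_i_norm : forall w z, adjoint A (i w) z ->
    rnorm w ^+ 2 = rnorm (i w) ^+ 2 + rnorm z ^+ 2;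
  triple_j_linear : linear j;
  triple_j_inj : injective j;
  triple_j_continuous : continuous j;
  triple_j_dense : dense (range j);
  triple_pair_linear : forall (a : R[i]) v v' w,
    pairing (a *: v + v') w = a * pairing v w + pairing v' w;
  triple_pair_antilinear : forall (a : R[i]) v w w',
    pairing v (a *: w + w') = a^* * pairing v w + pairing v w';
  triple_pair_bounded : forall v, exists M : R,
    forall w, rnorm (pairing v w : R[i]^o) <= M * rnorm w;
  triple_pair_norm : forall v,
    rnorm v = sup [set rnorm (pairing v w : R[i]^o) | w in [set w | rnorm w <= 1]];
  triple_pair_surj : forall f : W -> R[i],
    (forall (a : R[i]) w w', f (a *: w + w') = a^* * f w + f w') ->
    (exists M : R, forall w, rnorm (f w : R[i]^o) <= M * rnorm w) ->
    exists v, forall w, pairing v w = f w;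
  triple_pair_pivot : forall x w, pairing (j x) w = inner x (i w) }.

(* The generator of the extended semigroup extends A and has domain X. *)
Record semigroup_extension (X V : normedModType R[i]) (A : X -> X -> Prop)
    (j : X -> V) (S : R -> X -> X) (SV : R -> V -> V) : Prop := {
  extension_C0 : C0_semigroup SV;
  extension_eq : forall t, 0 <= t -> forall x, SV t (j x) = j (S t x);
  extension_generator : exists AV : V -> V -> Prop,
    [/\ is_generator AV SV,
        forall x y, A x y -> AV (j x) (j y) &
        [set v | exists v', AV v v'] = range j] }.

End Operators.

Section Control.
Variables (R : realType) (X V : normedModType R[i]) (j : X -> V).
Variables (S : R -> X -> X) (SV : R -> V -> V) (b : V).

Definition admissible_input : Prop :=
  forall u, in_L2loc u -> forall t : R, 0 <= t ->
    exists x, is_bochner_integral `[0, t] (fun tau => u tau *: SV (t - tau) b)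
                (j x).

(* x = x(t, x0, u) *)
Definition mild_solution (t : R) (x0 : X) (u : R -> R[i]) (x : X) : Prop :=
  exists y : V,
    is_bochner_integral `[0, t] (fun tau => u tau *: SV (t - tau) b) y /\
    j x = j (S t x0) + y.

Definition exact_null_controllable (t1 t2 : R) : Prop :=
  forall x0, exists u : R -> R[i],
    [/\ in_L2 `[0, t2] u,
        {ae @lebesgue_measure R, forall t, t2 <= t -> u t = 0} &
        mild_solution t1 x0 u 0].

End Control.

(* Main.v *)
From HB Require Import structures.
Require Import Defs.
From mathcomp Require Import all_boot all_order all_algebra.
From mathcomp Require Import complex ring lra.
From mathcomp Require Import all_classical all_reals all_analysis.
From mathcomp Require Import measurable_realfun.
Import Order.TTheory GRing.Theory Num.Theory.
Import numFieldNormedType.Exports.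
Import ComplexField.Normc.
Local Open Scope classical_set_scope.
Local Open Scope complex_scope.
Local Open Scope ring_scope.

Set Implicit Arguments.
Unset Strict Implicit.
Unset Printing Implicit Defensive.

(** Pairing with an eigenvector [psi_k] of the adjoint diagonalizes the dynamics:
    [(S(t) v, psi_k) = e^(lam_k t) (v, psi_k)] for every [v] in [V].  Hence, for
    a control [u] that vanishes after [s := t1 - T] and any [t >= s], the
    [psi_k]-coordinate of the mild solution at time [t] is [e^(lam_k t)] times
    [x_(0k) + int_0^s e^(- lam_k tau) b_k u(tau) dtau].  If the solution is [0]
    at [t1], all these brackets vanish, which is the moment problem.

    Conversely, if [u] solves the moment problem then all the coordinates of
    the state [w = x(s)] vanish.  For [t > T] the orbit [S(t) w] is a series of
    eigenvectors whose coefficients are its coordinates [e^(lam_k t) (w, psi_k)],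
    so [S(t) w = 0]; strong continuity extends this to [t = T].  As no control
    acts after [s], [x(t1) = S(T) w = 0].

    The eigenvalue relation ([pairing_semigroup_eigenvector]) is proved in
    three steps.  For [x] in [D(A)] the function [e^(- lam t) (S(t) x, psi)] has
    right derivative zero, uniformly in [t] because a [C0]-semigroup is bounded
    on bounded intervals ([C0_semigroup_bounded], from the Banach-Steinhaus
    theorem [uniform_boundedness]), so it is constant.  The spectrum has no
    finite limit point, so some [l] is in the resolvent set, and writing
    [x = (l - A) r] carries the relation to every [x] in [X].  Finally, the
    density of [X] in [V] carries it to [V].

    A bounded functional is exchanged with the Bochner integral through
    [L1_approximated], a notion of integral that asks for no measurability of
    the integrand: the Bochner integral comes with simple functions that are
    close to the integrand within a measurable error of small integral, and
    this alone determines the value ([L1_approximated_unique]).  So functionals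
    may be compared on [V]-valued integrands such as [SV T (F tau)]
    ([convolution_semigroup]), for which only the measurability of the errors
    [|F - simple function|] before applying [SV T] is known. *)

(** * Linear maps and real-valued norms *)

Section Linear_maps.
Variables (K : pzRingType) (X Y : lmodType K) (f : X -> Y).
Hypothesis lf : linear f.

Lemma linear_fun0 : f 0 = 0.
Proof. by have := lf (-1) 0 0; rewrite scaler0 addr0 scaleN1r addNr. Qed.

Lemma linear_funZ a x : f (a *: x) = a *: f x.
Proof. by have := lf a x 0; rewrite linear_fun0 !addr0. Qed.

Lemma linear_funD x y : f (x + y) = f x + f y.
Proof. by have := lf 1 x y; rewrite !scale1r. Qed.

Lemma linear_funB x y : f (x - y) = f x - f y.
Proof. by rewrite addrC -scaleN1r lf scaleN1r addrC. Qed.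

Lemma linear_fun_sum (I : Type) (r : seq I) (g : I -> X) :
  f (\sum_(i <- r) g i) = \sum_(i <- r) f (g i).
Proof.
elim/big_ind2: _ => [|? ? ? ? <- <-|//]; first exact: linear_fun0.
exact: linear_funD.
Qed.
End Linear_maps.

Section Real_norm.
Variables (R : realType) (X : normedModType R[i]).
Implicit Types (x y : X) (a : R[i]).

Lemma rnormE x : `|x| = (rnorm x)%:C.
Proof. by rewrite /rnorm RRe_real// normr_real. Qed.

Lemma normr_normc a : `|a| = (normc a)%:C.
Proof. by rewrite normc_def; case: a. Qed.

Lemma rnorm_ge0 x : 0 <= rnorm x.
Proof. by rewrite -lecR -rnormE normr_ge0. Qed.

Lemma rnorm0 : rnorm (0 : X) = 0.
Proof. by rewrite /rnorm normr0. Qed.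

Lemma rnorm_eq0 x : rnorm x = 0 -> x = 0.
Proof. by move=> x0; apply: normr0_eq0; rewrite rnormE x0. Qed.

Lemma rnormN x : rnorm (- x) = rnorm x.
Proof. by rewrite /rnorm normrN. Qed.

Lemma ler_rnormD x y : rnorm (x + y) <= rnorm x + rnorm y.
Proof.
by rewrite -lecR -rnormE (le_trans (ler_normD _ _))// 2!rnormE -rmorphD.
Qed.

Lemma ler_rnormB x y : rnorm (x - y) <= rnorm x + rnorm y.
Proof. by rewrite -(rnormN y) ler_rnormD. Qed.

Lemma rdistC x y : rnorm (x - y) = rnorm (y - x).
Proof. by rewrite -rnormN opprB. Qed.

Lemma rnormZ a x : rnorm (a *: x) = normc a * rnorm x.
Proof.
by apply: complexI; rewrite -rnormE normrZ normr_normc rnormE -rmorphM.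
Qed.

Lemma normc_ge0 a : 0 <= normc a.
Proof. by rewrite -lecR -normr_normc normr_ge0. Qed.

Lemma normcR (r : R) : normc r%:C = `|r|.
Proof. by rewrite /normc/= expr0n/= addr0 sqrtr_sqr. Qed.

(** Moves between the positive elements of [R[i]] that filter convergence
    quantifies over and the real [e]. *)
Lemma cvg_rnormP {T : Type} {F : set_system T} {FF : Filter F}
    (f : T -> X) (l : X) :
  f @ F --> l <->
  forall e : R, 0 < e -> \forall t \near F, rnorm (f t - l) <= e.
Proof.
split.
  move/cvgrPdist_le => fl e e0; have := fl e%:C; rewrite ltcR => /(_ e0).
  by apply: filterS => t; rewrite rnormE lecR rdistC.
move=> fl; apply/cvgrPdist_le => e e0.
have ere : e = (complex.Re e)%:C by rewrite RRe_real// gtr0_real.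
have /fl : 0 < complex.Re e by rewrite -ltcR -ere.
by apply: filterS => t; rewrite ere rnormE lecR rdistC.
Qed.

End Real_norm.

Lemma rnorm_regular (R : realType) (a : R[i]) : rnorm (a : R[i]^o) = normc a.
Proof. by rewrite /rnorm [X in complex.Re X]normr_normc. Qed.

Lemma continuous_linear_rnorm (R : realType) (X Y : normedModType R[i])
    (f : X -> Y) : linear f -> continuous f ->
  exists2 C : R, 0 < C & forall x, rnorm (f x) <= C * rnorm x.
Proof.
move=> lf cf.
pose g : {linear X -> Y} := HB.pack f (GRing.isLinear.Build _ _ _ _ _ lf).
have /linear_boundedP : bounded_near g (nbhs (0 : X)).
  exact/linear_bounded_continuous.
move/pinfty_ex_gt0 => [C C0 fC].
have CE : C = (complex.Re C)%:C by rewrite RRe_real// gtr0_real.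
exists (complex.Re C); first by rewrite -ltcR -CE.
by move=> x; rewrite -lecR -rnormE (le_trans (fC x))// rnormE {1}CE -rmorphM.
Qed.

(** * The uniform boundedness principle *)

(** The Baire argument, with nested balls.  Without a common bound, the [f m]
    are uniformly bounded on no ball, so each ball contains a smaller one on
    which, pointwise, some [f m] is at least [n]; the common point of a nested
    sequence of such balls, for all [n], contradicts pointwise boundedness. *)
Lemma uniform_boundedness (R : realType) (X : completeNormedModType R[i])
    (Y : normedModType R[i]) (f : nat -> X -> Y) :
  (forall m, linear (f m)) -> (forall m, continuous (f m)) ->
  (forall x, exists M : R, forall m, rnorm (f m x) <= M) ->
  exists M : R, forall m x, rnorm (f m x) <= M * rnorm x.
Proof.
move=> lf cf fb; apply: contrapT => nM.
have fB m := linear_funB (lf m).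
have fZ m := linear_funZ (lf m).
(* By linearity, a uniform bound on one ball would give one on [X]. *)
have big (n : nat) x (r : R) : 0 < r ->
    exists m y, rnorm (y - x) <= r /\ n%:R < rnorm (f m y).
  move=> r0; apply: contrapT => nb; apply: nM.
  have fnb m y : rnorm (y - x) <= r -> rnorm (f m y) <= n%:R.
    by move=> yx; rewrite leNgt; apply/negP => ny; apply: nb; exists m, y.
  exists (n%:R *+ 2 / r) => m z.
  have [->|z0] := eqVneq z 0.
    by rewrite -{1}(scale0r 0) fZ scale0r !rnorm0 mulr0.
  have nz0 : 0 < rnorm z.
    rewrite lt_neqAle rnorm_ge0 andbT eq_sym.
    by apply/eqP => /rnorm_eq0 zz; rewrite zz eqxx in z0.
  pose c : R := r / rnorm z.
  have c0 : 0 < c by rewrite divr_gt0.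
  have : rnorm (f m (c%:C *: z + x - x)) <= n%:R *+ 2.
    rewrite fB (le_trans (ler_rnormB _ _))// mulr2n lerD// fnb//.
      by rewrite addrK rnormZ normcR gtr0_norm// /c divfK// gt_eqF.
    by rewrite subrr rnorm0 ltW.
  rewrite addrK fZ rnormZ normcR gtr0_norm// /c mulrAC ler_pdivrMr//.
  by rewrite [r * _]mulrC -ler_pdivlMr// mulrAC.
(* The radius [d] is small enough for [rnorm (f m z)] to stay above [n] around
   [y]; halving keeps the balls nested and makes the radii tend to 0. *)
have step (n : nat) (p : X * {posnum R}) : exists q : X * {posnum R},
    [/\ rnorm (q.1 - p.1) + q.2%:num <= p.2%:num, q.2%:num <= p.2%:num / 2 &
        forall z, rnorm (z - q.1) <= q.2%:num ->
          exists m, n%:R <= rnorm (f m z)].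
  case: p => x r /=.
  have [m [y [yx ny]]] := big n x (r%:num / 2) ltac:(by rewrite divr_gt0).
  have [C C0 fC] := continuous_linear_rnorm (lf m) (cf m).
  pose d : R := Num.min (r%:num / 2) ((rnorm (f m y) - n%:R) / C).
  have d0 : 0 < d by rewrite lt_min !divr_gt0// subr_gt0.
  have d1 : d <= r%:num / 2 by rewrite ge_min lexx.
  have d2 : d <= (rnorm (f m y) - n%:R) / C by rewrite ge_min lexx orbT.
  exists (y, PosNum d0); split => //=.
    by rewrite (splitr r%:num) lerD.
  move=> z zy; exists m.
  have : rnorm (f m (y - z)) <= rnorm (f m y) - n%:R.
    rewrite (le_trans (fC _))// mulrC -ler_pdivlMr// rdistC.
    exact: le_trans d2.
  have : rnorm (f m y) <= rnorm (f m (y - z)) + rnorm (f m z).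
    by rewrite fB -{1}[f m y](subrK (f m z)) ler_rnormD.
  by lra.
have [s sP] := choice (fun np => step np.1 np.2).
pose fix p n := if n is k.+1 then s (k, p k) else (0 : X, PosNum (@ltr01 R)).
pose x n := (p n).1; pose r n : R := (p n).2%:num.
have pP n : [/\ rnorm (x n.+1 - x n) + r n.+1 <= r n, r n.+1 <= r n / 2 &
        forall z, rnorm (z - x n.+1) <= r n.+1 ->
          exists m, n%:R <= rnorm (f m z)] by exact: (sP (n, p n)).
have nest n k : rnorm (x (n + k)%N - x n) + r (n + k)%N <= r n.
  elim: k => [|k IH]; first by rewrite addn0 subrr rnorm0 add0r.
  rewrite addnS; have [h _ _] := pP (n + k)%N.
  have := ler_rnormD (x (n + k).+1 - x (n + k)%N) (x (n + k)%N - x n).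
  by rewrite addrA subrK; lra.
have rlim n : r n <= 2^-1 ^+ n.
  elim: n => [|n IH]; first by rewrite expr0; exact: lexx.
  by have [_ h _] := pP n; rewrite (le_trans h)// exprS mulrC ler_pM2l.
have r0 n : 0 <= r n by rewrite /r.
have near_x n k : (n <= k)%N -> rnorm (x k - x n) <= r n.
  by move=> /subnKC <-; have := nest n (k - n)%N; have := r0 (n + (k - n))%N; lra.
have cx : cauchy (x @ \oo).
  apply: cauchy_exP => e e0.
  have ere : e = (complex.Re e)%:C by rewrite RRe_real// gtr0_real.
  have e0' : 0 < complex.Re e by rewrite -ltcR -ere.
  have [n _ ne] : \forall n \near \oo, (2^-1 : R) ^+ n < complex.Re e.
    have /cvgrPdist_lt /(_ _ e0') : (2^-1 : R) ^+ n @[n --> \oo] --> 0.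
      by apply: cvg_expr; rewrite ger0_norm// invf_lt1// ltr1n.
    by apply: filterS => n; rewrite sub0r normrN ger0_norm// exprn_ge0.
  exists (x n); exists n => // k /= nk.
  rewrite -ball_normE /= rnormE ere ltcR rdistC.
  by rewrite (le_lt_trans (near_x _ _ nk))// (le_lt_trans (rlim n))//; apply: ne => /=.
have /cvg_ex[l xl] : cvg (x @ \oo) by exact: cauchy_cvg.
have ln n : rnorm (l - x n) <= r n.
  apply/ler_addgt0Pr => e e0.
  have /cvg_rnormP/(_ _ e0)[k _ kl] := xl.
  have := kl (maxn n k) (leq_maxr _ _).
  have := near_x n (maxn n k) (leq_maxl _ _).
  have := ler_rnormD (l - x (maxn n k)) (x (maxn n k) - x n).
  by rewrite addrA subrK (rdistC l (x (maxn n k))); lra.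
have [M fM] := fb l.
have [m] : exists m, (Num.truncn `|M|).+1%:R <= rnorm (f m l).
  by have [_ _] := pP (Num.truncn `|M|).+1; apply.
have := fM m; have := truncnS_gt `|M|; have := ler_norm M; lra.
Qed.

(** * Semigroups on bounded intervals *)

(** Near [0] this is uniform boundedness: if it failed, there would be
    [s_n] tending to 0 with [S s_n] of norm more than [n], although [S s_n x]
    converges for every [x].  The semigroup law then gives powers of the bound
    on longer intervals. *)
Lemma C0_semigroup_bounded (R : realType) (X : completeNormedModType R[i])
    (S : R -> X -> X) (t : R) : C0_semigroup S ->
  exists2 M : R, 0 <= M & forall s x, 0 <= s -> s <= t ->
    rnorm (S s x) <= M * rnorm x.
Proof.
case=> lS cS S0 SD Sc.
have [d d0 [M MS]] : exists2 d : R, 0 < d &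
    exists M : R, forall s x, 0 <= s -> s <= d -> rnorm (S s x) <= M * rnorm x.
  apply: contrapT => nd.
  have bad (n : nat) : exists sx : R * X, [/\ 0 <= sx.1, sx.1 <= n.+1%:R^-1 &
      n%:R * rnorm sx.2 < rnorm (S sx.1 sx.2)].
    apply: contrapT => nb; apply: nd; exists n.+1%:R^-1 => //; exists n%:R.
    move=> s x s0 sn; rewrite leNgt; apply/negP => h.
    by apply: nb; exists (s, x).
  have [p pP] := choice bad.
  have [| |x|M MS] := uniform_boundedness (f := fun n => S (p n).1).
  - by move=> n; apply: lS; case: (pP n).
  - by move=> n; apply: cS; case: (pP n).
  - have /cvg_rnormP/(_ 1 ltr01) := Sc x.
    move=> [e /= e0 eS].
    have [N Ne] : exists N : nat, N.+1%:R^-1 < e.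
      exists (Num.truncn e^-1).
      by rewrite -ltf_pV2 ?posrE// invrK truncnS_gt.
    (* [S (p m).1 x] is within 1 of [x] for [m >= N]; the sum covers [m < N]. *)
    exists (\sum_(k < N) rnorm (S (p k).1 x) + (1 + rnorm x)) => m.
    have [mN|Nm] := ltnP m N.
      rewrite (bigD1 (Ordinal mN))//= -addrA lerDl.
      by rewrite !addr_ge0 ?rnorm_ge0// sumr_ge0// => k _; exact: rnorm_ge0.
    have [s0 s1 _] := pP m.
    rewrite (@le_trans _ _ (1 + rnorm x))//; last first.
      by rewrite lerDr sumr_ge0// => k _; exact: rnorm_ge0.
    move: s0; rewrite le_eqVlt => /predU1P[<-|s0].
      by rewrite S0 lerDr.
    rewrite -[S _ x](subrK x) (le_trans (ler_rnormD _ _))// lerD2r.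
    apply: eS => //=; rewrite sub0r normrN gtr0_norm//.
    rewrite (le_lt_trans s1)// (le_lt_trans _ Ne)//.
    by rewrite lef_pV2 ?posrE// ler_nat.
  have [s0 _] := pP (Num.truncn `|M|).+1.
  have := MS (Num.truncn `|M|).+1 (p (Num.truncn `|M|).+1).2.
  move: (p _) => [s x]/= h1; apply/negP; rewrite -leNgt (le_trans h1)//.
  rewrite ler_wpM2r ?rnorm_ge0//.
  by have := truncnS_gt `|M|; have := ler_norm M; lra.
pose K : R := Num.max M 1.
have K1 : 1 <= K by rewrite le_max lexx orbT.
have KS s x : 0 <= s -> s <= d -> rnorm (S s x) <= K * rnorm x.
  move=> s0 sd; rewrite (le_trans (MS _ _ s0 sd))// ler_wpM2r ?rnorm_ge0//.
  by rewrite le_max lexx.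
have pow (n : nat) s x : 0 <= s -> s <= n%:R * d ->
    rnorm (S s x) <= K ^+ n * rnorm x.
  elim: n s => [|n IH] s s0 sn.
    have -> : s = 0 by apply/eqP; rewrite eq_le s0 andbT; rewrite mul0r in sn.
    by rewrite S0 expr0 mul1r.
  have [sd|ds] := leP s d.
    rewrite (le_trans (KS _ _ s0 sd))// ler_wpM2r ?rnorm_ge0//.
    by rewrite exprS ler_peMr ?exprn_ege1// (le_trans _ K1).
  have sd0 : 0 <= s - d by rewrite subr_ge0 ltW.
  rewrite -[s](subrKC d) SD ?(ltW d0)//.
  rewrite (le_trans (KS _ _ _ _)) ?(ltW d0)// exprS -mulrA.
  rewrite ler_wpM2l ?(le_trans _ K1)//; apply: IH => //.
  by move: sn; rewrite -natr1 mulrDl mul1r; lra.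
exists (K ^+ (Num.truncn `|t / d|).+1); first by rewrite exprn_ge0// (le_trans _ K1).
move=> s x s0 st; apply: pow => //; rewrite (le_trans st)// -ler_pdivrMr//.
by rewrite (le_trans (ler_norm _))// ltW// truncnS_gt.
Qed.

(** The uniformity of [d] in [s] is essential: a right-continuous step function
    has right derivative zero at every point.  It lets one telescope over a
    partition of [[0, t]] into equal steps shorter than [d]. *)
Lemma zero_right_derivative_constant (R : realType) (X : normedModType R[i])
    (g : R -> X) (t : R) : 0 <= t ->
  (forall e : R, 0 < e -> exists2 d : R, 0 < d & forall s h,
     0 <= s -> 0 < h -> h < d -> s + h <= t ->
     rnorm (g (s + h) - g s) <= e * h) ->
  g t = g 0.
Proof.
rewrite le_eqVlt => /predU1P[<-//|t0] gP.
apply/eqP; rewrite -subr_eq0; apply/eqP/rnorm_eq0/eqP.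
rewrite eq_le rnorm_ge0 andbT; apply/ler_addgt0Pr => e e0; rewrite add0r.
have [d d0 gd] := gP (e / t) (divr_gt0 e0 t0).
pose n := (Num.truncn (t / d)).+1.
have n0 : 0 < n%:R :> R by [].
pose h := t / n%:R.
have h0 : 0 < h by rewrite divr_gt0.
have hd : h < d by rewrite ltr_pdivrMr// mulrC -ltr_pdivrMr// truncnS_gt.
have tE : t = n%:R * h by rewrite mulrC divfK ?gt_eqF.
have step k : (k <= n)%N -> rnorm (g (k%:R * h) - g 0) <= k%:R * (e / t * h).
  elim: k => [|k IH] kn; first by rewrite !mul0r subrr rnorm0.
  rewrite -(subrKA (g (k%:R * h))) (le_trans (ler_rnormD _ _))//.
  rewrite -natr1 !mulrDl !mul1r [leRHS]addrC lerD ?IH 1?ltnW//.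
  apply: gd => //; first by rewrite mulr_ge0// ltW.
  by rewrite -[X in _ + X]mul1r -mulrDl natr1 [leRHS]tE ler_pM2r// ler_nat.
have := step n (leqnn n); rewrite -tE => /le_trans; apply.
by rewrite mulrCA -tE divfK ?gt_eqF.
Qed.

(** * The complex exponential *)

Section Complex_exponential.
Variable R : realType.
Implicit Types z w : R[i].

Lemma expC0 : expC (0 : R[i]) = 1.
Proof. by rewrite /expC/= expR0 cos0 sin0 mul1r. Qed.

Lemma expCD z w : expC (z + w) = expC z * expC w.
Proof.
case: z => a b; case: w => c d; rewrite /expC/= expRD cosD sinD.
by apply/eqP; rewrite eq_complex/=; apply/andP; split; apply/eqP; ring.
Qed.

Lemma expCNK z : expC (- z) * expC z = 1.
Proof. by rewrite -expCD addNr expC0. Qed.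

Lemma normc_expC z : normc (expC z) = expR (complex.Re z).
Proof.
rewrite /expC normcM normcR ger0_norm ?expR_ge0//= cos2Dsin2.
by rewrite sqrtr1 mulr1.
Qed.

Lemma normc_le_ReIm z : normc z <= `|complex.Re z| + `|complex.Im z|.
Proof.
case: z => a b; rewrite [X in normc X](_ : _ = a%:C + b%:C * 'i%C); last first.
  by apply/eqP; rewrite eq_complex/=; apply/andP; split; apply/eqP; ring.
rewrite (le_trans (le_normcD _ _))// normcM !normcR.
by rewrite [normc 'i%C]/= expr0n expr1n add0r sqrtr1 mulr1.
Qed.

(** From the derivatives at [0] of the real and imaginary parts of
    [h |-> expC (h z)]. *)
Lemma right_derivative_expC z (e : R) : 0 < e ->
  \forall h \near 0^'+, normc (expC (h%:C * z) - 1 - h%:C * z) <= e * h.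
Proof.
move=> e0; case: z => a b.
have dRe : is_derive (0 : R) 1 (fun h => expR (h * a) * cos (h * b)) a.
  apply: is_derive_eq.
  by rewrite /GRing.scale/= !mul0r expR0 cos0 sin0; ring.
have dIm : is_derive (0 : R) 1 (fun h => expR (h * a) * sin (h * b)) b.
  apply: is_derive_eq.
  by rewrite /GRing.scale/= !mul0r expR0 cos0 sin0; ring.
have key (f : R -> R) c : is_derive (0 : R) 1 f c ->
    \forall h \near 0^'+, `|f h - f 0 - h * c| <= e / 2 * h.
  move=> [df fc].
  have /cvgrPdist_le /(_ (e / 2)) := df.
  rewrite divr_gt0// => /(_ isT).
  rewrite -/(derive f 0 1) fc => -[d /= d0 H]; exists d => //= h hd h0.
  have := H h hd; rewrite gt_eqF// => /(_ isT).
  rewrite /= addr0 [h *: 1]mulr1 => fh.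
  have -> : f h - f 0 - h * c = - (h * (c - h^-1 * (f h - f 0))).
    by rewrite mulrBr mulrA divff ?gt_eqF// mul1r opprB.
  by rewrite normrN normrM gtr0_norm// mulrC ler_pM2r.
near=> h.
have h0 : 0 < h by [].
have -> : h%:C * (a +i* b) = (h * a) +i* (h * b).
  by apply/eqP; rewrite eq_complex/= !mul0r subr0 addr0 !eqxx.
rewrite (le_trans (normc_le_ReIm _))//=.
rewrite [leRHS](_ : _ = e / 2 * h + e / 2 * h); last first.
  by rewrite -mulrDl -splitr.
rewrite lerD//.
  have : `|expR (h * a) * cos (h * b) - expR (0 * a) * cos (0 * b) - h * a| <= e / 2 * h.
    by near: h; exact: key.
  by rewrite !mul0r expR0 cos0 !mulr1 subr0.
have : `|expR (h * a) * sin (h * b) - expR (0 * a) * sin (0 * b) - h * b| <= e / 2 * h.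
  by near: h; exact: key.
by rewrite !mul0r expR0 sin0 mulr0 addr0 !subr0.
Unshelve. all: by end_near. Qed.
End Complex_exponential.

(** * Orbits tested against eigenfunctionals *)

Section Eigenfunctionals.
Variables (R : realType) (X : completeNormedModType R[i]).
Variables (A : X -> X -> Prop) (S : R -> X -> X).
Hypotheses (S_C0 : C0_semigroup S) (A_gen : is_generator A S).

Lemma generator_orbit x x' (s : R) : 0 <= s -> A x x' -> A (S s x) (S s x').
Proof.
case: S_C0 => lS cS _ SD _ s0 /A_gen Ax; apply/A_gen.
have lSs := lS s s0.
apply: cvg_trans (continuous_cvg _ (cS s s0 x') Ax).
apply: near_eq_cvg; near=> h.
have h0 : 0 < h by [].
have h0' := ltW h0.
by rewrite [LHS]/= (linear_funZ lSs) (linear_funB lSs) -!SD// (addrC h).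
Unshelve. all: by end_near. Qed.

Variables (f : X -> R[i]) (lam : R[i]) (C : R).
Hypotheses (lf : linear (f : X -> R[i]^o))
  (fC : forall x, normc (f x) <= C * rnorm x)
  (f_eigen : forall x x', A x x' -> f x' = lam * f x).

(** Since [f] is an eigenfunctional of the generator, [e^(- lam s) f (S s x)]
    has right derivative zero.  The estimate is uniform in [s] because the
    remainder [S h x - x - h x'] is small independently of [s] and is then
    multiplied by [S s], which is bounded on [[0, t]]. *)
Lemma eigenfunctional_orbit_domain x x' (t : R) : 0 <= t -> A x x' ->
  f (S t x) = expC (lam * t%:C) * f x.
Proof.
move=> t0 Ax; have [M M0 MS] := C0_semigroup_bounded t S_C0.
have C0 : 0 <= `|C| by [].
have fC' y : normc (f y) <= `|C| * rnorm y.
  by rewrite (le_trans (fC y))// ler_wpM2r ?rnorm_ge0// ler_norm.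
pose g (s : R) : R[i]^o := expC (- (lam * s%:C)) * f (S s x).
suff gt0 : g t = g 0.
  have := congr1 (fun z => expC (lam * t%:C) * z) gt0; rewrite /g.
  rewrite mulrA [expC _ * expC _]mulrC expCNK mul1r => ->.
  by rewrite mulr0 oppr0 expC0 mul1r (semigroup_0 S_C0).
apply: zero_right_derivative_constant => // e e0.
(* [B] bounds [e^(- lam s)] on [[0, t]], and [K] collects the factors that
   multiply the errors made on [S h x] and on [e^(lam h)]. *)
pose B := expR (`|complex.Re lam| * t).
have B0 : 0 <= B by exact: expR_ge0.
pose K := B * (`|C| * M) * (1 + rnorm x) + 1.
have K0 : 0 < K by rewrite ltr_wpDl// !mulr_ge0// addr_ge0// rnorm_ge0.
have eK : 0 < e / K by rewrite divr_gt0.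
move/A_gen/cvg_rnormP : (Ax) => /(_ _ eK)[d1 /= d10 Hd1].
have [d2 /= d20 Hd2] := right_derivative_expC lam eK.
exists (Num.min d1 d2); first by rewrite lt_min d10.
move=> s h s0 h0; rewrite lt_min => /andP[hd1 hd2] sht.
have st : s <= t by rewrite (le_trans _ sht)// lerDl ltW.
have h0' := ltW h0.
have lSs := semigroup_linear S_C0 s0.
have {}Hd1 : rnorm (S h x - x - h%:C *: x') <= e / K * h.
  have -> : S h x - x - h%:C *: x' = h%:C *: (h%:C^-1 *: (S h x - x) - x').
    rewrite scalerBr scalerA divff ?scale1r// -(rmorph0 (real_complex R)).
    by rewrite (inj_eq (@complexI R)) gt_eqF.
  rewrite rnormZ normcR gtr0_norm// mulrC ler_pM2r// Hd1//=.
  by rewrite sub0r normrN gtr0_norm.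
have {}Hd2 : normc (expC (h%:C * lam) - 1 - h%:C * lam) <= e / K * h.
  by apply: Hd2 => //=; rewrite sub0r normrN gtr0_norm.
have -> : g (s + h) - g s = expC (- (lam * (s + h)%:C)) *
   (f (S s (S h x - x - h%:C *: x'))
      - (expC (h%:C * lam) - 1 - h%:C * lam) * f (S s x)).
  rewrite !(linear_funB lSs) !(linear_funB lf) (linear_funZ lSs) (linear_funZ lf).
  rewrite (f_eigen (generator_orbit s0 Ax)) -(semigroup_D S_C0)//.
  have -> : expC (- (lam * (s + h)%:C)) =
      expC (- (lam * s%:C)) * expC (- (h%:C * lam)).
    by rewrite -expCD rmorphD/=; congr expC; ring.
  rewrite /g.
  have -> : expC (- (lam * (s + h)%:C)) =
      expC (- (lam * s%:C)) * expC (- (h%:C * lam)).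
    by rewrite -expCD rmorphD/=; congr expC; ring.
  have E1 := expCNK (h%:C * lam).
  move: E1; set E := expC (h%:C * lam); set E' := expC (- (h%:C * lam)) => E1.
  rewrite /GRing.scale/=.
  transitivity (expC (- (lam * s%:C)) * E' * f (S (s + h) x)
                - expC (- (lam * s%:C)) * (E' * E) * f (S s x)).
    by rewrite E1 mulr1.
  by ring.
rewrite rnorm_regular normcM normc_expC.
have hB : expR (complex.Re (- (lam * (s + h)%:C))) <= B.
  rewrite ler_expR; case: (lam) => a b /=; rewrite mulr0 subr0 -mulNr.
  have sh0 : 0 <= s + h by rewrite addr_ge0.
  apply: (@le_trans _ _ (`|a| * (s + h))).
    by rewrite ler_wpM2r// -normrN ler_norm.
  by rewrite ler_wpM2l.
have hf : normc (f (S s (S h x - x - h%:C *: x')) -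
      (expC (h%:C * lam) - 1 - h%:C * lam) * f (S s x)) <=
      `|C| * M * (1 + rnorm x) * (e / K * h).
  rewrite (le_trans (le_normcD _ _))// normcN normcM.
  rewrite mulrDr mulr1 mulrDl lerD//.
    rewrite (le_trans (fC' _))// -mulrA ler_wpM2l//.
    by rewrite (le_trans (MS _ _ s0 st))// ler_wpM2l.
  rewrite mulrC ler_pM ?normc_ge0//.
  by rewrite (le_trans (fC' _))// -mulrA ler_wpM2l// MS.
apply: (le_trans (ler_pM _ _ hB hf)); rewrite ?expR_ge0 ?normc_ge0//.
rewrite !mulrA ler_pM2r// ler_pdivrMr// [leRHS]mulrC ler_pM2r//.
by rewrite /K !mulrA lerDl.
Qed.

(** Write [x = (l - A) y] with [l] in the resolvent set: [f] turns [l - A] into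
    the factor [l - lam] both before and after applying [S t], so the relation
    for [y] in the domain gives the one for [x]. *)
Lemma eigenfunctional_orbit x (t : R) : 0 <= t -> resolvent_set A !=set0 ->
  f (S t x) = expC (lam * t%:C) * f x.
Proof.
move=> t0 [l [/(_ x)[y [y' [Ay <-]]] _]].
have lS := semigroup_linear S_C0 t0.
have fy := eigenfunctional_orbit_domain t0 Ay.
rewrite (linear_funB lS) (linear_funZ lS) !(linear_funB lf) !(linear_funZ lf).
rewrite (f_eigen Ay) (f_eigen (generator_orbit t0 Ay)) fy /GRing.scale/=.
by ring.
Qed.

End Eigenfunctionals.

(** If the spectrum were the whole plane, [0] would be a limit point of it. *)
Lemma resolvent_set_neq0 (R : realType) (X : normedModType R[i])
    (A : X -> X -> Prop) :
  limit_point (spectrum A : set R[i]^o) = set0 -> resolvent_set A !=set0.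
Proof.
move=> lim0; apply/set0P/eqP => res0.
have : limit_point (spectrum A : set R[i]^o) 0.
  move=> U /nbhs_ballP[e /= e0 eU]; exists (e / 2); split.
  - by rewrite mulf_neq0 ?invr_eq0 ?pnatr_eq0// gt_eqF.
  - by rewrite /spectrum res0 setC0.
  - apply: eU; rewrite -ball_normE /= sub0r normrN gtr0_norm ?divr_gt0//.
    by rewrite ltr_pdivrMr// ltr_pMr// ltr1n.
by rewrite lim0.
Qed.

(** * Integrals determined by L1 approximation *)

Section L1_approximation.
Context d (T : measurableType d) (R : realType) (mu : {measure set T -> \bar R}).
Implicit Types (D : set T) (F : T -> R) (c : R).

(** An integral over [D] for functions [F] that need not be measurable: only
    the dominating errors [g n] are. *)
Definition L1_approximated D F c : Prop :=
  exists q g : nat -> T -> R,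
  [/\ forall n, mu.-integrable D (EFin \o q n),
      forall n, measurable_fun D (g n),
      forall n t, D t -> `|F t - q n t| <= g n t,
      (\int[mu]_(t in D) (g n t)%:E)%E @[n --> \oo] --> 0%E &
      Rintegral mu D (q n) @[n --> \oo] --> c].

(** The bound holds almost everywhere only, which serves controls that vanish
    almost everywhere outside of [D]. *)
Lemma cvg_Rintegral0 D (q g : nat -> T -> R) : measurable D ->
  (forall n, mu.-integrable D (EFin \o q n)) ->
  (forall n, measurable_fun D (g n)) ->
  (forall n t, D t -> 0 <= g n t) ->
  {ae mu, forall t, D t -> forall n, `|q n t| <= g n t} ->
  (\int[mu]_(t in D) (g n t)%:E)%E @[n --> \oo] --> 0%E ->
  Rintegral mu D (q n) @[n --> \oo] --> 0.
Proof.
move=> mD iq mg g0 qg g_cvg.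
have qgE n : (`|Rintegral mu D (q n)|%:E <= \int[mu]_(t in D) (g n t)%:E)%E.
  rewrite EFin_normr_Rintegral//; have /integrableP[mq _] := iq n.
  rewrite (le_trans (le_abse_integral _ _ _))//.
  apply: ae_ge0_le_integral => //.
  - apply/measurable_EFinP; apply: (measurableT_comp (@normr_measurable R setT)).
    exact/measurable_EFinP.
  - by move=> t Dt; rewrite lee_fin g0.
  - exact/measurable_EFinP.
  - by apply: filterS qg => t qgt Dt; rewrite lee_fin qgt.
have : `|Rintegral mu D (q n)|%:E @[n --> \oo] --> 0%E.
  apply: (@squeeze_cvge _ _ _ _ (cst 0%E) _ _ _ _ (cvg_cst _) g_cvg).
  by apply: nearW => n; rewrite lee_fin normr_ge0 qgE.
by move/fine_cvg/norm_cvg0P.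
Qed.

(** Two approximating sequences differ by at most [g n + g' n], where [F] has
    been eliminated and which is measurable with integral tending to 0. *)
Lemma L1_approximated_unique D F c c' : measurable D ->
  L1_approximated D F c -> L1_approximated D F c' -> c = c'.
Proof.
move=> mD [q [g [iq mg qg g0 qc]]] [q' [g' [iq' mg' qg' g'0 qc']]].
have g_ge0 n t : D t -> 0 <= g n t by move=> Dt; apply: le_trans (qg n t Dt).
have g'_ge0 n t : D t -> 0 <= g' n t by move=> Dt; apply: le_trans (qg' n t Dt).
apply/eqP; rewrite -subr_eq0; apply/eqP.
have qq' : Rintegral mu D (q n) - Rintegral mu D (q' n) @[n --> \oo] --> c - c'.
  exact: cvgB.
apply: cvg_unique qq' _ => //.
rewrite (_ : (fun n => _) =
    fun n => Rintegral mu D (fun t => q n t - q' n t)); last first.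
  by apply/funext => n; rewrite RintegralB.
apply: (@cvg_Rintegral0 D _ (fun n t => g n t + g' n t)) => //.
- by move=> n; exact: (integrableB mD (iq n) (iq' n)).
- by move=> n; apply: measurable_funD.
- by move=> n t Dt; rewrite addr_ge0 ?g_ge0 ?g'_ge0.
- apply: aeW => t Dt n.
  have -> : q n t - q' n t = (F t - q' n t) - (F t - q n t) by ring.
  by rewrite (le_trans (ler_normB _ _))// addrC lerD ?qg ?qg'.
- under eq_fun.
    move=> n; under eq_integral do rewrite EFinD.
    rewrite ge0_integralD//; first over.
    + by move=> t Dt; rewrite lee_fin g_ge0.
    + exact/measurable_EFinP.
    + by move=> t Dt; rewrite lee_fin g'_ge0.
    + exact/measurable_EFinP.
  by rewrite -[0%E]adde0; apply: cvgeD.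
Qed.

(** Where [F] vanishes, [|q n|] is itself dominated by [g n], so the part of
    its integral outside of [D] tends to 0. *)
Lemma L1_approximated_restrict D D' F c : measurable D -> measurable D' ->
  D `<=` D' -> {ae mu, forall t, D' t -> ~ D t -> F t = 0} ->
  L1_approximated D' F c -> L1_approximated D F c.
Proof.
move=> mD mD' DD' F0 [q [g [iq mg qg g0 qc]]].
have g_ge0 n t : D' t -> 0 <= g n t by move=> Dt; apply: le_trans (qg n t Dt).
have mDD' : measurable (D' `\` D) by exact: measurableD.
have shrink B : measurable B -> B `<=` D' ->
    (\int[mu]_(t in B) (g n t)%:E)%E @[n --> \oo] --> 0%E.
  move=> mB BD'.
  apply: (@squeeze_cvge _ _ _ _ (cst 0%E) _ _ _ _ (cvg_cst _) g0).
  apply: nearW => n; apply/andP; split.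
    by apply: integral_ge0 => t /BD' D't; rewrite lee_fin g_ge0.
  apply: ge0_subset_integral => //; first exact/measurable_EFinP.
  by move=> t D't; rewrite lee_fin g_ge0.
exists q, g; split.
- by move=> n; exact: integrableS (iq n).
- by move=> n; exact: measurable_funS (mg n).
- by move=> n t /DD'; exact: qg.
- exact: shrink.
- have q0 : Rintegral mu (D' `\` D) (q n) @[n --> \oo] --> 0.
    apply: (@cvg_Rintegral0 _ _ g) => //.
    + by move=> n; apply: integrableS (iq n).
    + by move=> n; apply: measurable_funS (mg n).
    + by move=> n t [/g_ge0].
    + apply: filterS F0 => t F0 [D't nDt] n.
      by have := qg n t D't; rewrite F0// sub0r normrN.
    + exact: shrink.
  have disj : [disjoint D & D' `\` D] by apply/disj_setPS; rewrite setDIK.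
  have qD n : Rintegral mu D (q n) =
      Rintegral mu D' (q n) - Rintegral mu (D' `\` D) (q n).
    have := Rintegral_setU (mu := mu) (f := q n) mD mDD'.
    by rewrite setDUK// => /(_ (iq n) disj) ->; rewrite addrK.
  rewrite -[c]subr0 (_ : (fun n => _) = fun n =>
    Rintegral mu D' (q n) - Rintegral mu (D' `\` D) (q n)); last exact/funext.
  exact: cvgB.
Qed.

(** A measurable [F] is integrable, being within [g n] of [q n], and then the
    constant sequence [F] approximates it with error 0. *)
Lemma L1_approximated_Rintegral D F c : measurable D -> measurable_fun D F ->
  L1_approximated D F c ->
  mu.-integrable D (EFin \o F) /\ Rintegral mu D F = c.
Proof.
move=> mD mF approxF; have [q [g [iq mg qg g0 qc]]] := approxF.
have g_ge0 n t : D t -> 0 <= g n t by move=> Dt; apply: le_trans (qg n t Dt).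
have iF : mu.-integrable D (EFin \o F).
  have [n gn] : exists n, (\int[mu]_(t in D) (g n t)%:E < +oo)%E.
    move/fine_cvgP : g0 => [[N _ gN] _]; exists N.
    by have /fin_numP[] := gN N (leqnn N); rewrite lt_neqAle leey => _ ->.
  have ig : mu.-integrable D (EFin \o g n).
    apply/integrableP; split; first exact/measurable_EFinP.
    under eq_integral.
      move=> t; rewrite inE => Dt.
      rewrite gee0_abs; first over.
      by rewrite lee_fin g_ge0.
    by [].
  have igq : mu.-integrable D (fun t => (g n t)%:E + `|(q n t)%:E|)%E.
    by apply: integrableD => //; exact: integrable_abse (iq n).
  apply: le_integrable igq => //; first exact/measurable_EFinP.
  move=> t Dt; rewrite /= lee_fin [leRHS]ger0_norm ?addr_ge0 ?g_ge0//.
  by rewrite -{1}[F t](subrK (q n t)) (le_trans (ler_normD _ _))// lerD2r qg.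
split => //; apply: (@L1_approximated_unique D F) => //.
exists (fun=> F), (fun=> cst 0); split => //.
- by move=> n t _; rewrite subrr normr0.
- by rewrite integral0; exact: cvg_cst.
- exact: cvg_cst.
Qed.

End L1_approximation.

(** * Functionals and the Bochner integral *)

Section Bochner_real_functional.
Variables (R : realType) (V : normedModType R[i]) (m : V -> R) (C : R).
Local Notation mu := (@lebesgue_measure R).
Hypotheses (mD : forall x y, m (x + y) = m x + m y)
  (mZ : forall (a : R) x, m (a%:C *: x) = a * m x)
  (mC : forall x, `|m x| <= C * rnorm x).

Let m0 : m 0 = 0.
Proof. by have := mD 0 0; rewrite addr0; lra. Qed.

Let mB x y : m (x - y) = m x - m y.
Proof.
by rewrite mD -scaleN1r -(rmorph1 (real_complex R)) -rmorphN mZ mulN1r.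
Qed.

Lemma functional_simple_integral (D : set R) (s : seq (set R * V)) :
  measurable D -> simple_on D s ->
  mu.-integrable D (EFin \o (fun t => m (simple_eval s t))) /\
  Rintegral mu D (fun t => m (simple_eval s t)) = m (simple_integral s).
Proof.
move=> mD'; elim: s => [|p s IH] sD.
  rewrite /simple_eval /simple_integral big_nil m0.
  under eq_fun do rewrite big_nil m0.
  split; first exact: integrable0.
  by rewrite Rintegral_cst// mul0r.
have [mp pD pfin] := sD p (mem_head _ _).
have [js Is] : mu.-integrable D (EFin \o (fun t => m (simple_eval s t))) /\
    Rintegral mu D (fun t => m (simple_eval s t)) = m (simple_integral s).
  by apply: IH => q qs; apply: sD; rewrite inE qs orbT.
have evalE : (fun t => m (simple_eval (p :: s) t)) =
    (fun t => \1_(p.1) t * m p.2 + m (simple_eval s t)).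
  apply/funext => t; rewrite /simple_eval big_cons mD; congr (_ + _).
  by rewrite -mZ; congr (m (_ *: _)); rewrite /indic rmorph_nat.
have I1 : (\int[mu]_(t in D) (\1_(p.1) t)%:E = mu p.1)%E.
  by rewrite integral_indic// setIidl.
have i1 : mu.-integrable D (EFin \o (\1_(p.1) : R -> R)).
  apply/integrableP; split; first exact/measurable_EFinP/measurable_indic.
  by under eq_integral do rewrite gee0_abs ?lee_fin//=; rewrite I1.
have ip : mu.-integrable D (EFin \o (fun t => \1_(p.1) t * m p.2)).
  exact: (integrableZr (mu := mu) mD' (m p.2) i1).
rewrite evalE; split; first exact: (integrableD (mu := mu) mD' ip js).
rewrite RintegralD// Is RintegralZr//.
by rewrite /simple_integral big_cons mD mZ /Rintegral I1.
Qed.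

(** The images under [m] of the simple functions approximate [m o f], with
    error at most [C] times the error in norm. *)
Lemma bochner_L1_approximated (D : set R) (f : R -> V) (v : V) :
  measurable D -> is_bochner_integral D f v ->
  L1_approximated mu D (fun t => m (f t)) (m v).
Proof.
move=> mD' [s [sD ms sf sv]].
have mC' x : `|m x| <= `|C| * rnorm x.
  by rewrite (le_trans (mC x))// ler_wpM2r ?rnorm_ge0// ler_norm.
exists (fun n t => m (simple_eval (s n) t)).
exists (fun n t => `|C| * rnorm (f t - simple_eval (s n) t)).
have sI n := functional_simple_integral mD' (sD n).
split.
- by move=> n; case: (sI n).
- move=> n; have cm : measurable_fun D (fun _ : R => `|C|) by exact: measurable_cst.
  exact: (measurable_funM cm (ms n)).
- by move=> n t _; rewrite -mB.
- rewrite (_ : (fun n => _) = (fun n => `|C|%:E *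
      \int[mu]_(t in D) (rnorm (f t - simple_eval (s n) t))%:E)%E); last first.
    apply/funext => n; under eq_integral do rewrite EFinM.
    rewrite ge0_integralZl//; first by apply/measurable_EFinP; exact: ms.
    by move=> t _; rewrite lee_fin rnorm_ge0.
  by rewrite -[0%E](mule0 `|C|%:E); apply: cvgeZl.
- rewrite (_ : (fun n => _) = (fun n => m (simple_integral (s n)))); last first.
    by apply/funext => n; case: (sI n).
  apply/cvgrPdist_le => e e0.
  have C1 : 0 < `|C| + 1 by rewrite ltr_wpDl.
  have eC : 0 < e / (`|C| + 1) by rewrite divr_gt0.
  move/cvg_rnormP : sv => /(_ _ eC); apply: filterS.
  move=> n; rewrite ler_pdivlMr// mulrC => h.
  rewrite -mB (le_trans (mC' _))// rdistC (le_trans _ h)//.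
  by rewrite ler_wpM2r ?rnorm_ge0// lerDl.
Qed.

End Bochner_real_functional.

Lemma normr_Re_le_normc (R : realType) (z : R[i]) : `|complex.Re z| <= normc z.
Proof. by rewrite -lecR -normr_normc; exact: normc_ge_Re. Qed.

Lemma normr_Im_le_normc (R : realType) (z : R[i]) : `|complex.Im z| <= normc z.
Proof.
case: z => a b; rewrite [normc _]/= -(sqrtr_sqr b).
by rewrite ler_sqrt ?addr_ge0 ?sqr_ge0// lerDr sqr_ge0.
Qed.

Section Bochner_functional.
Variables (R : realType) (V : normedModType R[i]).
Variables (f : V -> R[i]) (C : R).
Local Notation mu := (@lebesgue_measure R).
Hypotheses (lf : linear (f : V -> R[i]^o))
  (fC : forall x, normc (f x) <= C * rnorm x).

Lemma bochner_Re_approximated (D : set R) (F : R -> V) (v : V) :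
  measurable D -> is_bochner_integral D F v ->
  L1_approximated mu D (fun t => complex.Re (f (F t))) (complex.Re (f v)).
Proof.
move=> mD; apply: (@bochner_L1_approximated _ _ (fun x => complex.Re (f x)) C) => //.
- by move=> x y; rewrite (linear_funD lf) raddfD.
- move=> a x; rewrite (linear_funZ lf) /GRing.scale/=.
  by case: (f x) => p q /=; rewrite mul0r subr0.
- by move=> x; rewrite (le_trans (normr_Re_le_normc _)).
Qed.

Lemma bochner_Im_approximated (D : set R) (F : R -> V) (v : V) :
  measurable D -> is_bochner_integral D F v ->
  L1_approximated mu D (fun t => complex.Im (f (F t))) (complex.Im (f v)).
Proof.
move=> mD; apply: (@bochner_L1_approximated _ _ (fun x => complex.Im (f x)) C) => //.
- by move=> x y; rewrite (linear_funD lf) raddfD.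
- move=> a x; rewrite (linear_funZ lf) /GRing.scale/=.
  by case: (f x) => p q /=; rewrite mul0r addr0.
- by move=> x; rewrite (le_trans (normr_Im_le_normc _)).
Qed.

Lemma bochner_functional_cintegral (D D' : set R) (F : R -> V) (v : V) :
  measurable D -> measurable D' -> D `<=` D' ->
  {ae mu, forall t, D' t -> ~ D t -> f (F t) = 0} ->
  measurable_fun D (fun t => complex.Re (f (F t))) ->
  measurable_fun D (fun t => complex.Im (f (F t))) ->
  is_bochner_integral D' F v ->
  cintegral D (fun t => f (F t)) = f v.
Proof.
move=> mD mD' DD' F0 mRe mIm Fv; rewrite /cintegral.
have hRe : L1_approximated mu D (fun t => complex.Re (f (F t))) (complex.Re (f v)).
  apply: L1_approximated_restrict (bochner_Re_approximated mD' Fv) => //.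
  case: F0 => N [mN N0 NF]; exists N; split=> // t /= ht; apply: NF => /= h.
  by apply: ht => D't nDt; rewrite h.
have [_ ->] := L1_approximated_Rintegral (mu := mu) mD mRe hRe.
have hIm : L1_approximated mu D (fun t => complex.Im (f (F t))) (complex.Im (f v)).
  apply: L1_approximated_restrict (bochner_Im_approximated mD' Fv) => //.
  case: F0 => N [mN N0 NF]; exists N; split=> // t /= ht; apply: NF => /= h.
  by apply: ht => D't nDt; rewrite h.
have [_ ->] := L1_approximated_Rintegral (mu := mu) mD mIm hIm.
by case: (f v).
Qed.

End Bochner_functional.

Lemma L1_approximated_eq d (T : measurableType d) (R : realType)
    (mu : {measure set T -> \bar R}) (D : set T) (F G : T -> R) (c : R) :
  {in D, F =1 G} -> L1_approximated mu D F c -> L1_approximated mu D G c.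
Proof.
move=> FG [q [g [? ? qg ? ?]]]; exists q, g; split=> // n t Dt.
by rewrite -FG ?inE//; exact: qg.
Qed.

(** Functionals [f], [f'] that agree along two integrands agree on the two
    integrals, without any measurability of the common values. *)
Lemma bochner_functional_unique (R : realType) (V : normedModType R[i])
    (f f' : V -> R[i]) (C C' : R) (D D' : set R) (F F' : R -> V) (v v' : V) :
  linear (f : V -> R[i]^o) -> (forall x, normc (f x) <= C * rnorm x) ->
  linear (f' : V -> R[i]^o) -> (forall x, normc (f' x) <= C' * rnorm x) ->
  measurable D -> measurable D' -> D `<=` D' ->
  (forall t, D t -> f (F t) = f' (F' t)) ->
  (forall t, D' t -> ~ D t -> f' (F' t) = 0) ->
  is_bochner_integral D F v -> is_bochner_integral D' F' v' ->
  f v = f' v'.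
Proof.
move=> lf fC lf' fC' mD mD' DD' ff' f'0 Fv F'v'.
apply/eqP; rewrite eq_complex; apply/andP; split; apply/eqP.
  have h := bochner_Re_approximated lf fC mD Fv.
  apply: (L1_approximated_unique (mu := @lebesgue_measure R) mD h).
  apply: L1_approximated_eq
    (L1_approximated_restrict (mu := @lebesgue_measure R) mD mD' DD' _
    (bochner_Re_approximated lf' fC' mD' F'v')).
    by move=> t; rewrite inE => Dt; rewrite ff'.
  by apply: aeW => t D't nDt; rewrite f'0.
have h := bochner_Im_approximated lf fC mD Fv.
apply: (L1_approximated_unique (mu := @lebesgue_measure R) mD h).
apply: L1_approximated_eq
  (L1_approximated_restrict (mu := @lebesgue_measure R) mD mD' DD' _
  (bochner_Im_approximated lf' fC' mD' F'v')).
  by move=> t; rewrite inE => Dt; rewrite ff'.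
by apply: aeW => t D't nDt; rewrite f'0.
Qed.

(** * Duality and eigenvectors of the adjoint *)

Section Pivot_triple.
Variables (R : realType) (X W V : hilbertType R) (A : X -> X -> Prop).
Variables (i : W -> X) (j : X -> V) (pairing : V -> W -> R[i]).
Hypothesis WXV : pivot_triple A i j pairing.

Lemma pairing_linear w : linear (pairing ^~ w : V -> R[i]^o).
Proof. by move=> a x y; exact: (triple_pair_linear WXV). Qed.

(** The dual norm is a supremum over the unit ball of [W]; rescale [w]. *)
Lemma pairing_le v w : normc (pairing v w) <= rnorm w * rnorm v.
Proof.
have pZ a u : pairing v (a *: u) = a^* * pairing v u.
  have p0 : pairing v 0 = 0.
    have := triple_pair_antilinear WXV 1 v 0 0.
    rewrite rmorph1 scale1r addr0 mul1r => /eqP.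
    by rewrite -subr_eq0 opprD addNKr oppr_eq0 => /eqP.
  by have := triple_pair_antilinear WXV a v u 0; rewrite p0 !addr0.
have [->|w0] := eqVneq w 0.
  rewrite -(scale0r 0) pZ rmorph0 mul0r scale0r rnorm0 mul0r.
  by rewrite /normc/= expr0n/= addr0 sqrtr0.
have nw0 : 0 < rnorm w.
  rewrite lt_neqAle rnorm_ge0 andbT eq_sym.
  by apply/eqP => /rnorm_eq0 ww; rewrite ww eqxx in w0.
pose u := (rnorm w)^-1%:C *: w.
have u1 : rnorm u = 1.
  by rewrite rnormZ normcR gtr0_norm ?invr_gt0// mulVf// gt_eqF.
have wu : w = (rnorm w)%:C *: u.
  by rewrite scalerA -rmorphM divff ?gt_eqF// scale1r.
have conjR (r : R) : (r%:C)^* = r%:C by rewrite conj_Creal// complex_real.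
rewrite {1}wu pZ conjR normcM normcR gtr0_norm// ler_pM2l//.
rewrite (triple_pair_norm WXV) -rnorm_regular.
have [M hM] := triple_pair_bounded WXV v.
apply: ub_le_sup; last by exists u => //=; rewrite u1.
exists `|M| => _ [x /= x1 <-].
rewrite (le_trans (hM x))// (le_trans (ler_norm _))// normrM.
by rewrite ler_piMr// ger0_norm ?rnorm_ge0.
Qed.

Lemma pairing_separates v : (forall w, pairing v w = 0) -> v = 0.
Proof.
move=> v0; apply/rnorm_eq0/eqP; rewrite eq_le rnorm_ge0 andbT.
rewrite (triple_pair_norm WXV); apply: ge_sup.
  by exists (rnorm (pairing v 0 : R[i]^o)), 0 => //=; rewrite rnorm0.
by move=> _ [w _ <-]; rewrite v0 rnorm0.
Qed.

Lemma inner_i_linear w : linear ((fun x => inner x (i w)) : X -> R[i]^o).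
Proof. by move=> a x y; exact: inner_linearl. Qed.

(** Bounded because [inner x (i w)] is the pairing with [j x], and [j] is
    continuous. *)
Lemma inner_i_le w : exists C : R,
  forall x, normc (inner x (i w)) <= C * rnorm x.
Proof.
have [C _ jC] := continuous_linear_rnorm (triple_j_linear WXV)
  (triple_j_continuous WXV).
exists (rnorm w * C) => x; rewrite -(triple_pair_pivot WXV).
by rewrite (le_trans (pairing_le _ _))// -mulrA ler_wpM2l ?rnorm_ge0.
Qed.

Variables (S : R -> X -> X) (SV : R -> V -> V) (lam : R[i]) (psi : W).
Hypotheses (S_C0 : C0_semigroup S) (A_gen : is_generator A S).
Hypotheses (SV_ext : semigroup_extension A j S SV) (res : resolvent_set A !=set0).
Hypothesis psi_eigen : adjoint A (i psi) (lam^* *: i psi).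

Lemma inner_adjoint_eigenvector x x' :
  A x x' -> inner x' (i psi) = lam * inner x (i psi).
Proof.
move/psi_eigen => ->.
have i0 : inner (0 : X) x = 0.
  by rewrite -(linear_fun0 (fun a y z => inner_linearl a y z x : _ = _ :> R[i]^o)).
have := inner_linearl lam^* (i psi) 0 x; rewrite addr0 i0 addr0 => h.
by rewrite inner_conj h rmorphM /= conjCK -inner_conj.
Qed.

Lemma inner_semigroup_eigenvector x (t : R) : 0 <= t ->
  inner (S t x) (i psi) = expC (lam * t%:C) * inner x (i psi).
Proof.
have [C iC] := inner_i_le psi.
by move=> t0; apply: (eigenfunctional_orbit S_C0 A_gen (inner_i_linear psi) iC
  inner_adjoint_eigenvector).
Qed.

(** Both sides are bounded functionals of [v] that agree on the dense range of
    [j], by [inner_semigroup_eigenvector] and [SV t (j x) = j (S t x)]. *)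
Lemma pairing_semigroup_eigenvector v (t : R) : 0 <= t ->
  pairing (SV t v) psi = expC (lam * t%:C) * pairing v psi.
Proof.
move=> t0; have [SV_C0 SVj _] := SV_ext.
have lSV := semigroup_linear SV_C0 t0.
have [C C0 SVC] := continuous_linear_rnorm lSV (semigroup_bounded SV_C0 t0).
pose E := expC (lam * t%:C).
pose d v := pairing (SV t v) psi - E * pairing v psi.
pose K := rnorm psi * C + normc E * rnorm psi.
have dK u : normc (d u) <= K * rnorm u.
  rewrite (le_trans (le_normcD _ _))// mulrDl normcN normcM lerD//.
    by rewrite (le_trans (pairing_le _ _))// -mulrA ler_wpM2l ?rnorm_ge0.
  by rewrite -mulrA ler_wpM2l ?normc_ge0// pairing_le.
have dj x : d (j x) = 0.
  by rewrite /d SVj// !(triple_pair_pivot WXV) inner_semigroup_eigenvector// subrr.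
have dB u u' : d (u - u') = d u - d u'.
  rewrite /d (linear_funB lSV) !(linear_funB (pairing_linear psi)).
  by rewrite mulrBr; ring.
apply/eqP; rewrite -subr_eq0 -[X in X == _]/(d v); apply/eqP/eq0_normc/eqP.
rewrite eq_le normc_ge0 andbT; apply/ler_addgt0Pr => e e0; rewrite add0r.
have K0 : 0 <= K.
  by rewrite addr_ge0// mulr_ge0 ?rnorm_ge0 ?normc_ge0// ltW.
have K1 : 0 < K + 1 by rewrite ltr_wpDl.
have eK : 0 < (e / (K + 1))%:C by rewrite ltcR divr_gt0.
have [y [/= vx [x _ xE]]] : ball v (e / (K + 1))%:C `&` range j !=set0.
  apply: (triple_j_dense WXV); last exact: ball_open.
  by exists v; exact: ballxx.
move: vx; rewrite -xE -ball_normE /= rnormE ltcR ltr_pdivlMr// mulrC => vx.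
rewrite -[d v]subr0 -(dj x) -dB (le_trans (dK _))// (le_trans _ (ltW vx))//.
by rewrite ler_wpM2r ?rnorm_ge0// lerDl.
Qed.

End Pivot_triple.

(** * Coordinates of orbits and of convolutions *)

Section Complex_measurability.
Variables (R : realType) (D : set R).

Definition cmeasurable (f : R -> R[i]) : Prop :=
  measurable_fun D (fun t => complex.Re (f t)) /\
  measurable_fun D (fun t => complex.Im (f t)).

Lemma cmeasurableM (f g : R -> R[i]) :
  cmeasurable f -> cmeasurable g -> cmeasurable (fun t => f t * g t).
Proof.
move=> [f1 f2] [g1 g2]; split.
  rewrite (_ : (fun t => _) = fun t =>
    complex.Re (f t) * complex.Re (g t) - complex.Im (f t) * complex.Im (g t)).
    by apply: measurable_funB; apply: measurable_funM.
  by apply/funext => t; case: (f t); case: (g t).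
rewrite (_ : (fun t => _) = fun t =>
  complex.Re (f t) * complex.Im (g t) + complex.Im (f t) * complex.Re (g t)).
  by apply: measurable_funD; apply: measurable_funM.
by apply/funext => t; case: (f t); case: (g t).
Qed.

Lemma cmeasurable_cst (a : R[i]) : cmeasurable (fun=> a).
Proof. by split; exact: measurable_cst. Qed.

Lemma cmeasurable_expC (z : R[i]) : cmeasurable (fun t => expC (- (z * t%:C))).
Proof.
have mlin (c : R) : measurable_fun D (fun t : R => c * t).
  by apply: measurable_funM => //; exact: measurable_cst.
case: z => a b.
have mE : measurable_fun D (fun t : R => expR (- a * t)).
  by apply: measurableT_comp (mlin _); exact: measurable_expR.
have mC : measurable_fun D (fun t : R => cos (- b * t)).
  apply: measurableT_comp (mlin _).
  by apply: continuous_measurable_fun; exact: continuous_cos.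
have mS : measurable_fun D (fun t : R => sin (- b * t)).
  apply: measurableT_comp (mlin _).
  by apply: continuous_measurable_fun; exact: continuous_sin.
have E t : - ((a +i* b) * t%:C) = (- a * t) +i* (- b * t).
  by apply/eqP; rewrite eq_complex/= !mulr0 subr0 add0r !mulNr !eqxx.
split; under eq_fun do rewrite E /expC /=.
  under eq_fun do rewrite mul0r subr0.
  exact: measurable_funM mE mC.
under eq_fun do rewrite mul0r addr0.
exact: measurable_funM mE mS.
Qed.

End Complex_measurability.

(** The functionals [f k] are biorthogonal to the [phi k], so they read off the
    coefficients of the expansion of [S t x], which are therefore all 0. *)
Lemma eigenvector_expansion_eq0 (R : realType) (X : normedModType R[i])
    (S : R -> X -> X) (phi : nat -> X) (f : nat -> X -> R[i]) (T : R) (x : X) :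
  (forall k, linear (f k : X -> R[i]^o)) ->
  (forall k, exists C : R, forall x, normc (f k x) <= C * rnorm x) ->
  (forall k l, f l (phi k) = (k == l)%:R) ->
  eigenvector_expansion S phi T ->
  forall t, T < t -> (forall k, f k (S t x) = 0) -> S t x = 0.
Proof.
move=> lf fC fphi /(_ x)[c cS] t Tt fS0.
have {}cS : \sum_(l < n) c l t *: phi l @[n --> \oo] --> S t x.
  (* Uniform convergence on an interval within [(T, +oo)] that contains [t]
     gives convergence at [t]. *)
  have ht : [set t] `<=` `[(T + t) / 2, t + 1].
    by move=> _ ->; rewrite /= in_itv/=; apply/andP; split; lra.
  have := cS ((T + t) / 2) (t + 1) ltac:(lra) ltac:(lra).
  move/(uniform_subset_cvg _ ht).
  by rewrite uniform_set1.
suff c0 k : c k t = 0.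
  have S0 : \sum_(l < n) c l t *: phi l @[n --> \oo] --> (0 : X).
    rewrite (_ : (fun n => _) = cst 0); first exact: cvg_cst.
    by apply/funext => n; rewrite big1// => l _; rewrite c0 scale0r.
  exact: cvg_unique cS S0.
have [C fkC] := fC k.
apply/eq0_normc/eqP; rewrite eq_le normc_ge0 andbT.
apply/ler_addgt0Pr => e e0; rewrite add0r.
have C1 : 0 < `|C| + 1 by rewrite ltr_wpDl.
have eC : 0 < e / (`|C| + 1) by rewrite divr_gt0.
move/cvg_rnormP : cS => /(_ _ eC)[n _ /(_ (maxn n k.+1) (leq_maxl _ _))].
set N := maxn n k.+1; rewrite ler_pdivlMr// mulrC => h.
have kN : (k < N)%N by rewrite leq_max leqnn orbT.
(* [f k] of the [N]-th partial sum is [c k t] as soon as [k < N]. *)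
have -> : c k t = f k (\sum_(l < N) c l t *: phi l - S t x).
  rewrite (linear_funB (lf k)) fS0 subr0 (linear_fun_sum (lf k)).
  rewrite (bigD1 (Ordinal kN))//= (linear_funZ (lf k)) fphi eqxx.
  rewrite /GRing.scale/= mulr1 big1 ?addr0// => l lk.
  rewrite (linear_funZ (lf k)) fphi /GRing.scale/=.
  by rewrite -[_ == _]/(l == Ordinal kN) (negbTE lk) mulr0.
rewrite (le_trans (fkC _))// (le_trans _ h)// ler_wpM2r ?rnorm_ge0//.
by rewrite (le_trans (ler_norm _))// lerDl.
Qed.

(** The [psi]-coordinate of the controlled part of a mild solution.  The
    functional [f := e^(- lam t) (-, psi)] turns the integrand into the one of
    the moment problem, which does not depend on [t]. *)
Lemma pairing_convolution (R : realType) (X W V : hilbertType R)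
    (A : X -> X -> Prop) (S : R -> X -> X) (i : W -> X) (j : X -> V)
    (pairing : V -> W -> R[i]) (SV : R -> V -> V) (b : V) (lam : R[i]) (psi : W)
    (u : R -> R[i]) (s t : R) (y : V) :
  C0_semigroup S -> is_generator A S -> pivot_triple A i j pairing ->
  semigroup_extension A j S SV -> resolvent_set A !=set0 ->
  adjoint A (i psi) (lam^* *: i psi) ->
  s <= t -> in_L2 `[0, s] u ->
  {ae @lebesgue_measure R, forall tau, s < tau -> u tau = 0} ->
  is_bochner_integral `[0, t] (fun tau => u tau *: SV (t - tau) b) y ->
  pairing y psi = expC (lam * t%:C) *
    cintegral `[0, s]
      (fun tau => expC (- (lam * tau%:C)) * pairing b psi * u tau).
Proof.
move=> S_C0 A_gen WXV SV_ext res psi_eig st [mRe mIm _] u0 ybi.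
pose f v : R[i] := expC (- (lam * t%:C)) * pairing v psi.
have lf : linear (f : V -> R[i]^o).
  by move=> a x z; rewrite /f (triple_pair_linear WXV) /GRing.scale/=; ring.
have fC x : normc (f x) <= normc (expC (- (lam * t%:C))) * rnorm psi * rnorm x.
  by rewrite normcM -mulrA ler_wpM2l ?normc_ge0// (pairing_le WXV).
pose G tau := expC (- (lam * tau%:C)) * pairing b psi * u tau.
have fG tau : tau <= t -> f (u tau *: SV (t - tau) b) = G tau.
  move=> taut; rewrite /f (linear_funZ (pairing_linear WXV psi)) /GRing.scale/=.
  rewrite (pairing_semigroup_eigenvector WXV S_C0 A_gen SV_ext res psi_eig) ?subr_ge0//.
  have E : expC (- (lam * tau%:C)) =
      expC (- (lam * t%:C)) * expC (lam * (t - tau)%:C).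
    by rewrite -expCD rmorphB/=; congr expC; ring.
  by rewrite /G E; ring.
have [GRe GIm] : cmeasurable `[0, s] G.
  apply: cmeasurableM; last by split.
  by apply: cmeasurableM; [exact: cmeasurable_expC|exact: cmeasurable_cst].
have fGs : {in `[0, s]%classic, G =1 fun tau => f (u tau *: SV (t - tau) b)}.
  by move=> tau; rewrite inE /= in_itv/= => /andP[_ /le_trans/(_ st)] /fG ->.
have sub : `[0, s] `<=` `[0, t].
  by apply: subset_itvl; rewrite bnd_simp.
suff <- : f y = cintegral `[0, s] G.
  by rewrite /f mulrA [X in X * _]mulrC expCNK mul1r.
have cE : cintegral `[0, s] G =
    cintegral `[0, s] (fun tau => f (u tau *: SV (t - tau) b)).
  by congr (_ +i* _); apply: eq_Rintegral => tau /fGs ->.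
rewrite cE; apply/esym; apply: (bochner_functional_cintegral lf fC _ _ sub) => //.
- case: u0 => N [mN N0 NF]; exists N; split=> // tau /= htau; apply: NF => /= h.
  apply: htau; rewrite !in_itv/= => /andP[tau0 taut] /negP.
  by rewrite tau0/= -ltNge => /h ->; rewrite scale0r (linear_fun0 lf).
- apply: eq_measurable_fun GRe => tau /fGs -> //.
- apply: eq_measurable_fun GIm => tau /fGs -> //.
Qed.

Lemma in_L2loc_restrict (R : realType) (s : R) (u : R -> R[i]) :
  in_L2 `[0, s] u ->
  in_L2loc (fun t => if t \in `[0, s]%R then u t else 0).
Proof.
move=> [mRe mIm u2] r r0; set v := (fun t : R => if _ then _ else _).
have vRe : (fun t => complex.Re (v t)) = (fun t => complex.Re (u t)) \_ `[0, s].
  by apply/funext => t; rewrite /v patchE mem_setE; case: ifP.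
have vIm : (fun t => complex.Im (v t)) = (fun t => complex.Im (u t)) \_ `[0, s].
  by apply/funext => t; rewrite /v patchE mem_setE; case: ifP.
have mvRe : measurable_fun setT (fun t : R => complex.Re (v t)).
  by rewrite vRe; apply/(measurable_restrictT _ _).1.
have mvIm : measurable_fun setT (fun t : R => complex.Im (v t)).
  by rewrite vIm; apply/(measurable_restrictT _ _).1.
split; try exact: measurable_funS (measurableT) _ _.
apply: le_lt_trans u2.
pose g (w : R -> R[i]) t : \bar R := (complex.Re (w t) ^+ 2 + complex.Im (w t) ^+ 2)%:E.
have gv : g v = g u \_ `[0, s].
  apply/funext => t; rewrite /g /v patchE mem_setE; case: ifP => //= _.
  by rewrite !expr0n/= addr0.
change (\int[@lebesgue_measure R]_(t in `[0%R, r]) g v t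
        <= \int[@lebesgue_measure R]_(t in `[0%R, s]) g u t)%E.
rewrite [leRHS]integral_mkcond -gv.
apply: ge0_subset_integral => //.
  by apply/measurable_EFinP; apply: measurable_funD; apply: measurable_funX.
by move=> t _; rewrite lee_fin addr_ge0 ?sqr_ge0.
Qed.

(** After the control is switched off at time [s], the controlled part evolves
    freely.  Both sides are compared through the functionals [(-, w)], which
    separate the points of [V]; they agree on the integrands since
    [SV t (SV (s - tau) b) = SV (t + s - tau) b]. *)
Lemma convolution_semigroup (R : realType) (X W V : hilbertType R)
    (A : X -> X -> Prop) (S : R -> X -> X) (i : W -> X) (j : X -> V)
    (pairing : V -> W -> R[i]) (SV : R -> V -> V) (b : V)
    (u : R -> R[i]) (s t : R) (z z' : X) :
  pivot_triple A i j pairing -> semigroup_extension A j S SV ->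
  0 <= s -> 0 <= t -> (forall tau, s < tau -> u tau = 0) ->
  is_bochner_integral `[0, s] (fun tau => u tau *: SV (s - tau) b) (j z) ->
  is_bochner_integral `[0, t + s] (fun tau => u tau *: SV (t + s - tau) b) (j z') ->
  z' = S t z.
Proof.
move=> WXV SV_ext s0 t0 u0 zbi z'bi; apply: (triple_j_inj WXV).
have [SV_C0 SVj _] := SV_ext.
have lSV := semigroup_linear SV_C0 t0.
have [C C0 SVC] := continuous_linear_rnorm lSV (semigroup_bounded SV_C0 t0).
rewrite -SVj//; apply/eqP; rewrite -subr_eq0; apply/eqP.
apply: (pairing_separates WXV) => w.
rewrite (linear_funB (pairing_linear WXV w)); apply/eqP; rewrite subr_eq0; apply/eqP/esym.
apply: (bochner_functional_unique (f := fun v => pairing (SV t v) w)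
  (f' := pairing ^~ w) (C := rnorm w * C) (C' := rnorm w) (D := `[0, s])
  (D' := `[0, t + s]) _ _ (pairing_linear WXV w) _ _ _ _ _ _ zbi z'bi) => //.
- by move=> a x y; rewrite lSV (triple_pair_linear WXV).
- move=> x; rewrite (le_trans (pairing_le WXV _ _))// -mulrA.
  by rewrite ler_wpM2l ?rnorm_ge0.
- by move=> x; exact: pairing_le WXV _ _.
- by apply: subset_itvl; rewrite bnd_simp lerDr.
- move=> tau; rewrite /= in_itv/= => /andP[tau0 taus].
  by rewrite (linear_funZ lSV) -(semigroup_D SV_C0)// ?subr_ge0// addrA.
- move=> tau; rewrite /= !in_itv/= => /andP[-> taut] /negP; rewrite -ltNge => /u0 ->.
  by rewrite scale0r (linear_fun0 (pairing_linear WXV w)).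
Qed.

(** * Null-controllability *)

Theorem theorem1 (R : realType) (X W V : hilbertType R)
    (A : X -> X -> Prop) (S : R -> X -> X)
    (i : W -> X) (j : X -> V) (pairing : V -> W -> R[i])
    (SV : R -> V -> V) (b : V)
    (lam : nat -> R[i]) (phi : nat -> X) (psi : nat -> W) (T t1 : R)
    (X_separable : separable X)
    (S_C0 : C0_semigroup S)
    (A_generator : is_generator A S)
    (WXV : pivot_triple A i j pairing)
    (SV_extends : semigroup_extension A j S SV)
    (b_admissible : admissible_input j SV b)
    (A_spectrum : simple_discrete_spectrum A)
    (lam_enum : eigenvalue_enumeration A lam)
    (phi_eigen : forall k, A (phi k) (lam k *: phi k))
    (psi_eigen : forall k, adjoint A (i (psi k)) ((lam k)^* *: i (psi k)))
    (phi_psi : forall k l, inner (phi k) (i (psi l)) = (k == l)%:R)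
    (T_ge0 : 0 <= T)
    (A_expansion : eigenvector_expansion S phi T)
    (t1_gtT : T < t1) :
  exact_null_controllable j S SV b t1 (t1 - T) <->
  (forall x0 : X, exists u : R -> R[i],
     in_L2 `[0, t1 - T] u /\
     forall k, inner x0 (i (psi k)) =
       - cintegral `[0, t1 - T]
           (fun tau => expC (- (lam k * tau%:C)) * pairing b (psi k) * u tau)).
Proof.
have res : resolvent_set A !=set0.
  by case: A_spectrum => _ lim0 _; exact: resolvent_set_neq0 lim0.
have [s0 s0' t10] : [/\ 0 < t1 - T, 0 <= t1 - T & 0 <= t1].
  by split; lra.
have inner_S k t x : 0 <= t ->
    inner (S t x) (i (psi k)) = expC (lam k * t%:C) * inner x (i (psi k)).
  move=> t0.
  exact: (inner_semigroup_eigenvector WXV S_C0 A_generator res (psi_eigen k)).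
have conv k u t y : t1 - T <= t -> in_L2 `[0, t1 - T] u ->
    {ae @lebesgue_measure R, forall tau, t1 - T < tau -> u tau = 0} ->
    is_bochner_integral `[0, t] (fun tau => u tau *: SV (t - tau) b) y ->
    pairing y (psi k) = expC (lam k * t%:C) * cintegral `[0, t1 - T]
      (fun tau => expC (- (lam k * tau%:C)) * pairing b (psi k) * u tau).
  exact: (pairing_convolution S_C0 A_generator WXV SV_extends res (psi_eigen k)).
have jlin := triple_j_linear WXV.
split=> [null x0|moment x0].
  have [u [uL2 u0 [y [ybi ysol]]]] := null x0.
  exists u; split=> // k.
  have u0' : {ae @lebesgue_measure R, forall tau, t1 - T < tau -> u tau = 0}.
    case: u0 => N [mN N0 NF]; exists N; split=> // t /= ht; apply: NF => /= h.
    by apply: ht => tau; apply: h; exact: ltW.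
  have := congr1 (pairing ^~ (psi k)) ysol.
  rewrite /= (linear_fun0 jlin) (linear_fun0 (pairing_linear WXV (psi k))).
  rewrite (linear_funD (pairing_linear WXV (psi k))) (triple_pair_pivot WXV).
  rewrite inner_S// (conv k u t1 y _ uL2 u0' ybi); last by lra.
  rewrite -mulrDr => /(congr1 (fun z => expC (- (lam k * t1%:C)) * z)).
  rewrite mulr0 mulrA expCNK mul1r => /esym/eqP.
  by rewrite addr_eq0 => /eqP.
have [u [uL2 umom]] := moment x0.
pose v (t : R) : R[i] := if t \in `[0, t1 - T]%R then u t else 0.
have vloc : in_L2loc v := in_L2loc_restrict uL2.
have vL2 : in_L2 `[0, t1 - T] v by exact: vloc.
have v0 tau : t1 - T < tau -> v tau = 0.
  by move=> h; rewrite /v in_itv/= [tau <= _]leNgt h andbF.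
have v0ae : {ae @lebesgue_measure R, forall tau, t1 - T < tau -> v tau = 0}.
  by apply: aeW => tau; exact: v0.
have [z zbi] := b_admissible v vloc (t1 - T) s0'.
have [z1 z1bi] := b_admissible v vloc t1 t10.
have t1E : t1 = T + (t1 - T) by ring.
have z1E : z1 = S T z.
  rewrite t1E in z1bi.
  exact: (convolution_semigroup WXV SV_extends s0' T_ge0 v0 zbi z1bi).
(* The moment problem says that all the coordinates of the state
   [w = S (t1 - T) x0 + z] at time [t1 - T] vanish. *)
have w_orth k : inner (S (t1 - T) x0 + z) (i (psi k)) = 0.
  rewrite (linear_funD (inner_i_linear i (psi k))) -(triple_pair_pivot WXV z).
  rewrite inner_S// (conv k v _ _ _ vL2 v0ae zbi)// -mulrDr umom.
  rewrite (_ : cintegral _ (fun tau => _ * v tau) = cintegral `[0, t1 - T]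
    (fun tau => expC (- (lam k * tau%:C)) * pairing b (psi k) * u tau)).
    by rewrite addNr mulr0.
  by congr (_ +i* _); apply: eq_Rintegral => tau; rewrite inE /v /= => ->.
set w := S (t1 - T) x0 + z in w_orth.
have Sw t : T < t -> S t w = 0.
  move=> Tt; apply: (eigenvector_expansion_eq0 (fun k => inner_i_linear i (psi k))
    (fun k => inner_i_le WXV (psi k)) phi_psi A_expansion Tt) => k.
  by rewrite inner_S ?w_orth ?mulr0// (le_trans T_ge0)// ltW.
have STw : S T w = 0.
  have S0 : S h (S T w) @[h --> 0^'+] --> (0 : X).
    apply: cvg_near_cst; near=> h.
    have h0 : 0 < h by [].
    by rewrite -(semigroup_D S_C0) ?(ltW h0)// Sw// ltrDr.
  have S1 : S h (S T w) @[h --> 0^'+] --> S T w by exact: semigroup_strong S_C0 _.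
  exact: cvg_unique S1 S0.
(* [v] may differ from 0 at the single point [t1 - T], a null set. *)
exists v; split=> //.
  exists [set t1 - T]; split; first exact: measurable_set1.
    exact: lebesgue_measure_set1.
  move=> tau /=; apply: contra_notP => /eqP taus.
  by rewrite le_eqVlt eq_sym (negbTE taus)/=; exact: v0.
exists (j z1); split=> //.
rewrite -(linear_funD jlin); congr j; rewrite z1E {1}t1E.
rewrite (semigroup_D S_C0)// -(linear_funD (semigroup_linear S_C0 T_ge0)).
by rewrite -/w STw.
Unshelve. all: by end_near. Qed.
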